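(* For every $\epsilon>0$ there exists $n_0$ such that for all $n>n_0$ we have $f(n,6)\le n^{1+\epsilon}$.
   Context: $Q_n$ denotes the $n$-dimensional hypercube: its vertices are the binary vectors of length $n$, two vertices adjacent iff they differ in exactly one coordinate. $f(n,6)$ is the minimum number of colors in an edge-coloring of $Q_n$ such that the edges of every copy of the 6-cycle $C_6$ in $Q_n$ receive 6 distinct colors. *)

(* Defs.v *)
From mathcomp Require Import all_boot.

Set Implicit Arguments.
Unset Strict Implicit.
Unset Printing Implicit Defensive.

Definition cube (n : nat) : finType := {ffun 'I_n -> bool}.

Definition cube_adj (n : nat) : rel (cube n) :=
  fun x y => #|[set i | x i != y i]| == 1.

Definition is_cube_edge (n : nat) (A : {set cube n}) : bool :=
  [exists x : cube n, exists y : cube n, cube_adj x y && (A == [set x; y])].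

Notation cube_edge n := {A : {set cube n} | is_cube_edge A}.

(* A copy of C_l (l >= 3) is given by its cyclic sequence s of l pairwise
   distinct vertices, consecutive ones (cyclically) being adjacent. *)
Definition cycle_edges (n : nat) (s : seq (cube n)) : {set cube_edge n} :=
  [set e : cube_edge n | [exists x in s, val e == [set x; next s x]]].

Definition rainbow_coloring (n l k : nat) (c : {ffun cube_edge n -> 'I_k}) :
    bool :=
  [forall s : l.-tuple (cube n), ucycleb (@cube_adj n) s ==>
     [forall e in cycle_edges s, forall e' in cycle_edges s,
        (c e == c e') ==> (e == e')]].

Definition rainbow_colorable (n l k : nat) : bool :=
  [exists c : {ffun cube_edge n -> 'I_k}, rainbow_coloring l c].

Lemma ex_rainbow_colorable (n l : nat) : exists k, rainbow_colorable n l k.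
Proof.
exists #|{: cube_edge n}|; apply/existsP; exists [ffun e => enum_rank e].
apply/forallP => s; apply/implyP => _.
apply/forall_inP => e _; apply/forall_inP => e' _; apply/implyP.
by rewrite !ffunE => /eqP/enum_rank_inj ->.
Qed.

(* The minimum number f(n, l) of colors; only l >= 3 is meaningful. *)
Definition min_rainbow_colors (n l : nat) : nat :=
  ex_minn (ex_rainbow_colorable n l).

(* Main.v *)
(* Give coordinate i a weight a_i in an abelian group such that 2 a_p = a_q + a_r
   forces p = q (no 3-term progressions).  The edge joining L to U = L + i (as
   sets of coordinates) gets the color (w(L) + 2 a_i, |L| mod 4), with w the total
   weight.  Two vertices of a 6-cycle are at Hamming distance at most 3, so two of
   its edges with equal colors have bottoms L, L' at the same level.  If L <> L',
   then L = C + u and L' = C + v, and the distance of the tops forces i = i',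
   i = v or i' = u; in each case equality of the colors is a progression.
   Points (x, |x|^2) with x in {0..q-1}^k are progression-free by strict convexity,
   and live in a group of order O_k(q^(k+2)); taking q about n^(1/k) yields
   O_k(n^(1+2/k)) colors. *)
Require Import Defs.
From HB Require Import structures.
From mathcomp Require Import all_boot all_order all_algebra.
From mathcomp Require Import reals exp.
From mathcomp Require Import zify ring.

Set Implicit Arguments.
Unset Strict Implicit.
Unset Printing Implicit Defensive.

Import Order.TTheory GRing.Theory Num.Theory.
Local Open Scope ring_scope.

(** * Hamming distance, and its bound along a 6-cycle *)

Definition hamming n (x y : cube n) := #|[set i | x i != y i]|.

Lemma hammingC n (x y : cube n) : hamming x y = hamming y x.
Proof. by apply: eq_card => i; rewrite !inE eq_sym. Qed.

Lemma hamming_triangle n (y x z : cube n) :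
  (hamming x z <= hamming x y + hamming y z)%N.
Proof.
apply: leq_trans (leq_card_setU _ _); apply/subset_leq_card/subsetP => i.
by rewrite !inE; case: (x i) (y i) (z i) => [] [] [].
Qed.

Lemma cycle6_hamming n (s : 6.-tuple (cube n)) x y :
  cycle (@cube_adj n) s -> x \in s -> y \in s -> (hamming x y <= 3)%N.
Proof.
move=> cs xs ys; have [i t def_t] := rot_to xs.
have size_t : size (x :: t) = 6%N by rewrite -def_t size_rot size_tuple.
move: cs ys; rewrite -(rot_cycle i) -[y \in _](mem_rot i) def_t.
case: t size_t {def_t} => [|a [|b [|c [|d [|e [|? ?]]]]]] //= _.
have adjE u v : cube_adj u v = (hamming u v == 1%N) by [].
rewrite !adjE => /and5P[/eqP xa /eqP ab /eqP bc /eqP cd /and3P[/eqP de /eqP ex _]].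
(* From [x], the vertices [b] and [c] are reached forwards through [a], and [d] backwards through
   [e]; the shorter way round has at most three steps. *)
have xb := hamming_triangle a x b; have xc := hamming_triangle b x c.
have xd := hamming_triangle e x d; rewrite (hammingC x e) (hammingC e d) in xd.
have xx : hamming x x = 0%N by apply: eq_card0 => j; rewrite !inE eqxx.
rewrite !inE => /or4P[||| /or3P[]] /eqP->;
  rewrite ?(hammingC x e); lia.
Qed.

(** * Edges of the cube as pairs of coordinate sets *)

(** Intersection and union of the two endpoints seen as coordinate sets, so that an unordered edge
    gets an orientation without any choice. *)
Definition bottom n (A : {set cube n}) := [set i | [forall (x | x \in A), x i]].
Definition top n (A : {set cube n}) := [set i | [exists (x | x \in A), x i]].

Lemma cube_edgeP n (A : {set cube n}) : is_cube_edge A ->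
  [/\ A = [set [ffun i => i \in bottom A]; [ffun i => i \in top A]]
    & exists2 i, i \notin bottom A & top A = i |: bottom A].
Proof.
case/existsP=> x /existsP[y /andP[/cards1P[i def_i] /eqP->]].
have neq_xy j : (x j != y j) = (j == i) by have /setP/(_ j) := def_i; rewrite !inE.
wlog xi : x y {def_i} neq_xy / x i = false.
  move=> IH; case xi: (x i); last exact: IH.
  rewrite setUC; apply: IH => [j|]; first by rewrite eq_sym.
  by have := neq_xy i; rewrite eqxx xi; case: (y i).
have yi : y i by have := neq_xy i; rewrite eqxx xi; case: (y i).
have eq_xy j : j != i -> x j = y j.
  by rewrite -neq_xy negbK => /eqP.
have bE : bottom [set x; y] = [set j | x j].
  apply/setP => j; rewrite !inE; apply/forall_inP/idP => [-> //|xj z].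
    by rewrite !inE eqxx.
  case/set2P=> -> //; rewrite -eq_xy //.
  by apply: contraTneq xj => ->; rewrite xi.
have tE : top [set x; y] = [set j | y j].
  apply/setP => j; rewrite !inE; apply/exists_inP/idP => [[z]|yj].
    case/set2P=> -> // xj; rewrite -eq_xy //.
    by apply: contraTneq xj => ->; rewrite xi.
  by exists y; rewrite ?inE ?eqxx ?orbT.
rewrite bE tE; split.
  by congr [set _; _]; apply/ffunP => j; rewrite ffunE inE.
exists i; first by rewrite inE xi.
apply/setP => j; rewrite !inE; case: (eqVneq j i) => [->|/eq_xy-> //].
by rewrite yi.
Qed.

Lemma hamming_set n (A B : {set 'I_n}) :
  hamming [ffun i => i \in A] [ffun i => i \in B] =
  (#|A :\: B| + #|B :\: A|)%N.
Proof.
rewrite -cardsUI (_ : _ :&: _ = set0) ?cards0 ?addn0.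
  by apply: eq_card => i; rewrite !inE !ffunE; do 2!case: (i \in _).
by apply/setP => i; rewrite !inE; do 2!case: (i \in _).
Qed.

(** * The coloring given by progression-free weights *)

Section Coloring.

Variables (n : nat) (G : finZmodType) (a : 'I_n -> G).
Hypothesis a_free : forall p q r, a p + a p = a q + a r -> p = q.

Let w (A : {set 'I_n}) := \sum_(i in A) a i.

Lemma edge_color_inj (L L' : {set 'I_n}) i i' :
    i \notin L -> i' \notin L' ->
    #|L| = #|L'| -> (#|L :\: L'| + #|L' :\: L| <= 3)%N ->
    (#|(i |: L) :\: (i' |: L')| + #|(i' |: L') :\: (i |: L)| <= 3)%N ->
    w L + a i *+ 2 = w L' + a i' *+ 2 ->
  L = L' /\ i = i'.
Proof.
move=> iL iL' eqLL' dL dU.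
have cL := cardsID L' L; have cL' := cardsID L L'; rewrite setIC in cL'.
have [D0|Dn0] := posnP #|L :\: L'|.
  have sLL' : L \subset L' by rewrite -setD_eq0 -cards_eq0 D0.
  have -> : L = L' by apply/eqP; rewrite eqEcard sLL' eqLL' leqnn.
  by move/addrI; rewrite !mulr2n => /a_free ->.
(* Both differences have the same size, as [#|L| = #|L'|], and the sizes add up to at most 3. *)
have /eqP/cards1P[u Du] : #|L :\: L'| = 1%N by lia.
have /eqP/cards1P[v Dv] : #|L' :\: L| = 1%N by lia.
have : u \in L :\: L' by rewrite Du set11.
have : v \in L' :\: L by rewrite Dv set11.
rewrite !inE => /andP[vL vL'] /andP[uL' uL].
have neq_uv : u != v by apply: contraNneq vL => <-.
have LE j : j \in L' = (j == v) || (j != u) && (j \in L).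
  have := erefl (j \in L' :\: L); rewrite {2}Dv !inE.
  have := erefl (j \in L :\: L'); rewrite {2}Du !inE.
  case: (eqVneq j u) => [->|_]; first by rewrite (negPf uL') (negPf neq_uv).
  by case: (j == v) (j \in L) (j \in L') => [] [] [].
have wL : w L = a u + w (L :\ u) by rewrite /w (big_setD1 u).
have wL' : w L' = a v + w (L :\ u).
  rewrite /w (big_setD1 v) //=; congr (_ + _); apply: eq_bigl => j.
  rewrite !inE LE; case: (eqVneq j v) => // -> /=.
  by rewrite (negPf vL) andbF.
rewrite {}wL {}wL' !mulr2n ![_ + w _]addrC -!addrA => /addrI E.
(* Cancelling the weight of [L :\ u], the common part, leaves in [E] the relation
   [a u + 2 a i = a v + 2 a i']. *)
case: (eqVneq i i') => [ii'|neq_ii'].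
  move: E; rewrite ii' => /addIr auv.
  (* Injectivity of [a] comes from the degenerate progression [a v + a v = a u + a v]. *)
  have vu := a_free (congr1 (+%R^~ (a v)) (esym auv)).
  by rewrite vu eqxx in neq_uv.
case: (eqVneq i v) => [iv|neq_iv].
  move: E; rewrite iv addrCA => /addrI E.
  (* Here [a i'] is the midpoint of [a u] and [a v], so [i'] equals both. *)
  have uE := a_free (esym E); rewrite addrC in E.
  by have vE := a_free (esym E); rewrite -uE vE eqxx in neq_uv.
case: (eqVneq i' u) => [iu|neq_iu].
  move: E; rewrite iu [RHS]addrCA => /addrI /a_free iv.
  by rewrite iv eqxx in neq_iv.
(* Otherwise the tops differ in the four coordinates [u], [i], [v], [i'], one too many. *)
have neq_ui : u != i by apply: contraNneq iL => <-.
have neq_vi' : v != i' by apply: contraNneq iL' => <-; rewrite LE eqxx.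
have : (#|[set u; i]| <= #|(i |: L) :\: (i' |: L')|)%N.
  apply/subset_leq_card/subsetP => j /set2P[] ->; rewrite !inE LE.
    by rewrite eqxx uL (negPf neq_uv) [u == i']eq_sym (negPf neq_iu) orbT.
  by rewrite eqxx (negPf neq_ii') (negPf neq_iv) (negPf iL) andbF.
have : (#|[set v; i']| <= #|(i' |: L') :\: (i |: L)|)%N.
  apply/subset_leq_card/subsetP => j /set2P[] ->; rewrite !inE.
    by rewrite vL' orbT [v == i]eq_sym (negPf neq_iv) (negPf vL).
  rewrite eqxx [i' == i]eq_sym (negPf neq_ii') andbT /=.
  apply: contra iL'; rewrite LE neq_iu => ->; exact: orbT.
by rewrite !cards2 neq_ui neq_vi'; lia.
Qed.

Lemma rainbow_colorable6 : rainbow_colorable n 6 (4 * #|G|).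
Proof.
(* [2 w(U) - w(L)] equals [w(L) + 2 a_i], without mentioning the direction i. *)
pose color (e : cube_edge n) : G * 'I_4 :=
  (w (top (val e)) *+ 2 - w (bottom (val e)), inord (#|bottom (val e)| %% 4)).
suff: rainbow_colorable n 6 #|{: G * 'I_4}| by rewrite card_prod card_ord mulnC.
apply/existsP; exists [ffun e => enum_rank (color e)].
apply/forallP => s; apply/implyP => /andP[cs _].
apply/forall_inP => e eP; apply/forall_inP => e' e'P; apply/implyP.
rewrite !ffunE => /eqP/enum_rank_inj.
have in_s f z : f \in cycle_edges s -> z \in val f -> z \in s.
  rewrite inE => /exists_inP[x xs /eqP->] /set2P[] -> //.
  by rewrite mem_next.
have {}eP z := in_s e z eP; have {}e'P z := in_s e' z e'P.
rewrite -val_eqE /color.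
have [eE [i iL UE]] := cube_edgeP (valP e).
have [e'E [i' iL' UE']] := cube_edgeP (valP e').
set L := bottom (val e) in eE iL UE *; set L' := bottom (val e') in e'E iL' UE' *.
set U := top (val e) in eE UE *; set U' := top (val e') in e'E UE' *.
have dist (A B : {set 'I_n}) :
    [ffun j => j \in A] \in val e -> [ffun j => j \in B] \in val e' ->
    (#|A :\: B| + #|B :\: A| <= 3)%N.
  by move=> /eP Ae /e'P Be; rewrite -hamming_set (cycle6_hamming cs).
have dL : (#|L :\: L'| + #|L' :\: L| <= 3)%N.
  by apply: (dist L L'); [rewrite eE | rewrite e'E]; apply: set21.
have dU : (#|(i |: L) :\: (i' |: L')| + #|(i' |: L') :\: (i |: L)| <= 3)%N.
  by rewrite -UE -UE'; apply: dist; [rewrite eE | rewrite e'E]; apply: set22.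
case=> wE /(congr1 val); rewrite /= !inordK ?ltn_mod // => modE.
have cL := cardsID L' L; have cL' := cardsID L L'; rewrite setIC in cL'.
have eqLL' : #|L| = #|L'|.
  (* The differences have sizes [p] and [q], at most 3 apart, so the level modulo 4 determines the
     level. *)
  have mod4 p q r : (p + q <= 3 -> r + p = r + q %[mod 4] -> p = q)%N by lia.
  by rewrite -cL -cL' in modE *; rewrite (mod4 _ _ _ dL modE).
have wU j (A : {set 'I_n}) : j \notin A ->
    w (j |: A) *+ 2 - w A = w A + a j *+ 2.
  by move=> jA; rewrite /w big_setU1 //= mulrnDl -addrA mulr2n addrK addrC.
rewrite UE UE' !wU // in wE.
have [LL' ii'] := edge_color_inj iL iL' eqLL' dL dU wE.
by rewrite eE e'E UE UE' LL' ii'.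
Qed.

End Coloring.

(* The library does not declare these joins; without them the product group that
   receives [paraboloid] is not recognized as a [finZmodType]. *)
HB.instance Definition _ (A B : finZmodType) := GRing.Zmodule.on (A * B)%type.
HB.instance Definition _ (I : finType) (A : finZmodType) :=
  GRing.Zmodule.on {ffun I -> A}.

(** * Progression-free points on a paraboloid *)

Lemma inord_midpoint m x y z :
    (x + x <= m)%N -> (y + z <= m)%N ->
    inord x + inord x = inord y + inord z :> 'I_m.+1 ->
  (x + x = y + z)%N.
Proof.
move=> xm yzm /(congr1 val) /=.
by rewrite !inordK ?ltnS ?modn_small //; lia.
Qed.

(** The moduli exceed twice the largest coordinates, so a sum of two points never wraps around. *)
Definition paraboloid k q (x : {ffun 'I_k -> 'I_q}) :
    {ffun 'I_k -> 'I_(2 * q).+1} * 'I_(2 * (k * q ^ 2)).+1 :=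
  ([ffun j => inord (x j)], inord (\sum_j x j ^ 2)).

Lemma paraboloid_free k q (x y z : {ffun 'I_k -> 'I_q}) :
  paraboloid x + paraboloid x = paraboloid y + paraboloid z -> x = y.
Proof.
have sum_le (t : {ffun 'I_k -> 'I_q}) : (\sum_j t j ^ 2 <= k * q ^ 2)%N.
  rewrite -[k in (k * _)%N]card_ord -sum_nat_const leq_sum // => j _.
  by rewrite leq_exp2r // ltnW.
move=> E; have /ffunP E1 := congr1 fst E.
have /inord_midpoint E2 := congr1 snd E.
have {}E1 j : (x j + x j = y j + z j)%N.
  have := E1 j; rewrite !ffunE => /inord_midpoint; apply.
    by have := ltn_ord (x j); lia.
  by have := ltn_ord (y j); have := ltn_ord (z j); lia.
have {}E2 : (\sum_j (x j ^ 2 + x j ^ 2) = \sum_j (y j ^ 2 + z j ^ 2))%N.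
  rewrite !big_split; apply: E2.
    by have := sum_le x; lia.
  by have := sum_le y; have := sum_le z; lia.
(* Convexity in each coordinate with its equality case; as the sums over [j] agree, [leqif_sum]
   forces equality everywhere. *)
have le2 j : true ->
    (x j ^ 2 + x j ^ 2 <= y j ^ 2 + z j ^ 2 ?= iff (x j == y j :> nat))%N.
  move=> _; have := E1 j; move: (x j : nat) (y j : nat) (z j : nat) => a b c abc.
  (* The number [d] is the distance from the midpoint [a] to [b], hence also to [c]. *)
  have [d abd] : exists d, b = (a + d)%N \/ a = (b + d)%N.
    by case: (leqP a b) => ab; [exists (b - a)%N | exists (a - b)%N]; lia.
  have bcE : (b ^ 2 + c ^ 2 = a ^ 2 + a ^ 2 + 2 * d ^ 2)%N.
    by rewrite !expnS !expn0; nia.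
  split; first by rewrite bcE leq_addr.
  rewrite bcE -[X in X == _]addn0 eqn_add2l eq_sym muln_eq0 expn_eq0 andbT /=.
  by apply/idP/idP; lia.
have [_] := leqif_sum le2; rewrite E2 eqxx => /esym/forallP xy.
by apply/ffunP => j; apply/val_inj/eqP/(xy j).
Qed.

Lemma rainbow_colorable6_paraboloid n k q : (n <= q ^ k)%N ->
  rainbow_colorable n 6 (4 * ((2 * q).+1 ^ k * (2 * (k * q ^ 2)).+1)).
Proof.
move=> nqk.
have nle : (n <= #|{ffun 'I_k -> 'I_q}|)%N by rewrite card_ffun !card_ord.
have -> : ((2 * q).+1 ^ k * (2 * (k * q ^ 2)).+1)%N =
    #|{: {ffun 'I_k -> 'I_(2 * q).+1} * 'I_(2 * (k * q ^ 2)).+1}|.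
  by rewrite card_prod card_ffun !card_ord.
apply: (rainbow_colorable6
  (a := fun i => paraboloid (enum_val (widen_ord nle i)))).
by move=> p r t /paraboloid_free/enum_val_inj/(congr1 val) pr; apply: val_inj.
Qed.

(** * Choice of parameters and count of the colors *)

Lemma min_rainbow_colors_le n l k :
  rainbow_colorable n l k -> (min_rainbow_colors n l <= k)%N.
Proof. by rewrite /min_rainbow_colors; case: ex_minnP => m _; apply. Qed.

Lemma paraboloid_card_le k q : (0 < k)%N -> (0 < q)%N ->
  (4 * ((2 * q).+1 ^ k * (2 * (k * q ^ 2)).+1) <=
   4 * 3 ^ k.+1 * k * q ^ k.+2)%N.
Proof.
move=> k0 q0.
have H1 : ((2 * q).+1 ^ k <= 3 ^ k * q ^ k)%N.
  by rewrite -expnMn leq_exp2r //; lia.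
have H2 : ((2 * (k * q ^ 2)).+1 <= 3 * (k * q ^ 2))%N.
  by have : (0 < k * q ^ 2)%N; [rewrite muln_gt0 k0 expn_gt0 q0 | lia].
apply: leq_trans (leq_mul (leqnn 4) (leq_mul H1 H2)) _.
by rewrite !expnS; apply/eq_leq; ring.
Qed.

Theorem theorem2 (R : realType) (eps : R) (eps_gt0 : 0 < eps) :
  exists n0 : nat, forall n : nat, (n0 < n)%N ->
    (min_rainbow_colors n 6)%:R <= n%:R `^ (1 + eps) :> R.
Proof.
pose k := (Num.truncn (2 / eps)).+1.
have k_gt0 : 0 < k%:R :> R by rewrite ltr0n.
have eps_k : 2 / k%:R < eps.
  by rewrite ltr_pdivrMr // mulrC -ltr_pdivrMr // truncnS_gt.
(* The factor [2 ^ k.+2] pays for the bound [q <= 2 r] below. *)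
pose C : nat := (4 * 3 ^ k.+1 * k * 2 ^ k.+2)%N.
(* The spare exponent [d] absorbs [C]: [n ^ d] exceeds [C] once [n] exceeds [C ^ (1 / d)]. *)
pose d := eps - 2 / k%:R.
have d_gt0 : 0 < d by rewrite subr_gt0.
exists (Num.truncn (C%:R `^ d^-1 : R)) => n n0n.
have n_gt0 : (0 < n)%N by apply: leq_ltn_trans n0n.
have Cn : C%:R <= n%:R `^ d :> R.
  have -> : C%:R = (C%:R `^ d^-1) `^ d :> R.
    by rewrite -powRrM mulVf ?gt_eqF // powRr1.
  rewrite ge0_ler_powR ?nnegrE ?powR_ge0 ?ler0n ?(ltW d_gt0) //.
  by rewrite ltW // -(truncn_lt_nat _ (powR_ge0 _ _)).
pose r : R := n%:R `^ k%:R^-1.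
have r_ge1 : 1 <= r.
  by rewrite /r -[leLHS](powRr0 n%:R) ler_powR ?ler1n ?invr_ge0 ?ler0n.
(* Rounding [r] strictly up ensures [n <= q ^ k], and [r >= 1] keeps [q] at most [2 r]. *)
pose q := (Num.truncn r).+1.
have qr : q%:R <= r *+ 2.
  rewrite -natr1 mulr2n lerD //.
  by have /andP[] := truncn_itv (le_trans ler01 r_ge1).
have rk : r ^+ k = n%:R.
  by rewrite -powR_mulrn ?powR_ge0 // -powRrM mulVf ?gt_eqF // powRr1.
have nqk : (n <= q ^ k)%N.
  rewrite -(ler_nat R) natrX -rk lerXn2r ?nnegrE ?powR_ge0 //.
  by rewrite ltW // truncnS_gt.
have rk2 : r ^+ k.+2 = n%:R `^ (1 + 2 / k%:R).
  rewrite -powR_mulrn ?powR_ge0 // -powRrM; congr (_ `^ _).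
  by rewrite -addn2 natrD; field; rewrite gt_eqF.
have := min_rainbow_colors_le (rainbow_colorable6_paraboloid nqk).
move/leq_trans/(_ (paraboloid_card_le (ltn0Sn _) (ltn0Sn _))).
rewrite -(ler_nat R) => /le_trans; apply.
rewrite natrM natrX.
apply: le_trans (_ : C%:R * r ^+ k.+2 <= _).
  rewrite [X in _ <= X * _]natrM natrX -mulrA ler_wpM2l // -exprMn.
  by rewrite lerXn2r ?nnegrE ?mulr_ge0 ?powR_ge0 // mulr_natl.
have -> : 1 + eps = d + (1 + 2 / k%:R) by rewrite /d; ring.
rewrite powRD; last by rewrite pnatr_eq0 -lt0n n_gt0 implybT.
by rewrite rk2 ler_wpM2r ?powR_ge0.
Qed.
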